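(* Let $\mathcal{P}=\mathcal{P}'\uplus\{\ell\to\{p_1:r_1,\dots,p_k:r_k\}^m\}$ be an ADP problem, let $1\le j\le k$ and $t\trianglelefteq_\# r_j$, and let $\delta_1,\dots,\delta_d$ ($d\ge0$) be all narrowing substitutions of $t$. Let $N=\{\ell\delta_e\to\{p_1:r_1\delta_e,\dots,p_k:r_k\delta_e\}^m\mid 1\le e\le d\}\cup\{\ell\to\{p_1:\#_{\mathrm{capt}_1(\delta_1,\dots,\delta_d)}(r_1),\dots,p_k:\#_{\mathrm{capt}_k(\delta_1,\dots,\delta_d)}(r_k)\}^m\}$. Then $\mathcal{P}$ is iAST if and only if $\mathcal{P}'\cup N$ is iAST (i.e., the rule overlap instantiation processor $\mathrm{Proc}_{\mathtt{roi}}(\mathcal{P})=\{\mathcal{P}'\cup N\}$ is sound and complete).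
   Context: Fix a finite signature $\Sigma=\mathcal{D}\uplus\mathcal{C}$ (defined symbols and constructors) and a set of variables $\mathcal{V}$; all left-hand sides of ADPs have root in $\mathcal{D}$. For each $f\in\mathcal{D}$ let $f^\#$ be a fresh symbol of the same arity, $\mathcal{D}^\#=\{f^\#\mid f\in\mathcal{D}\}$, $\Sigma^\#=\Sigma\uplus\mathcal{D}^\#$; elements of $\mathcal{T}(\Sigma^\#,\mathcal{V})$ are annotated terms. $\mathrm{pos}_{\Sigma'}(t)$ is the set of positions of $t$ carrying a symbol of $\Sigma'$. For $\Phi\subseteq\mathrm{pos}_{\mathcal{D}\cup\mathcal{D}^\#}(r)$, $\#_\Phi(r)$ annotates exactly the symbols at positions in $\Phi$ and removes all other annotations; $\flat(t)$ removes all annotations from $t$; $\flat_{\uparrow\pi}(t)$ removes all annotations strictly above position $\pi$. $t\trianglelefteq_\# s$ means $t=\flat(s|_\pi)$ for some $\pi\in\mathrm{pos}_{\mathcal{D}^\#}(s)$. A finite multi-distribution on $A\neq\emptyset$ is a finite multiset of pairs $(p:a)$, $0<p\le1$, $a\in A$, with probabilities summing to 1. An ADP is $\ell\to\{p_1:r_1,\dots,p_k:r_k\}^m$ with $\ell\in\mathcal{T}(\Sigma,\mathcal{V})\setminus\mathcal{V}$, $m\in\{\mathsf{true},\mathsf{false}\}$, $\{p_1:r_1,\dots,p_k:r_k\}$ a finite multi-distribution on $\mathcal{T}(\Sigma^\#,\mathcal{V})$, $\mathcal{V}(r_j)\subseteq\mathcal{V}(\ell)$. An ADP problem is a finite set $\mathcal{P}$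 of ADPs. An annotated term $t$ is a $\mathcal{P}$-normal form if no subterm of $\flat(t)$ is an instance of a left-hand side of $\mathcal{P}$; $\mathtt{ANF}_{\mathcal{P}}$ is the set of annotated terms whose proper subterms are all $\mathcal{P}$-normal forms. $s\hookrightarrow_{\mathcal{P}}\{p_1:t_1,\dots,p_k:t_k\}$ holds if there are an ADP $\ell\to\{p_1:r_1,\dots,p_k:r_k\}^m\in\mathcal{P}$, a substitution $\sigma$ and $\pi\in\mathrm{pos}_{\mathcal{D}\cup\mathcal{D}^\#}(s)$ with $\flat(s|_\pi)=\ell\sigma\in\mathtt{ANF}_{\mathcal{P}}$ such that for all $j$: (pr) $t_j=s[r_j\sigma]_\pi$ if $\pi\in\mathrm{pos}_{\mathcal{D}^\#}(s)$, $m=\mathsf{true}$; (p) $t_j=\flat_{\uparrow\pi}(s[r_j\sigma]_\pi)$ if $\pi\in\mathrm{pos}_{\mathcal{D}^\#}(s)$, $m=\mathsf{false}$; (r) $t_j=s[\flat(r_j)\sigma]_\pi$ if $\pi\notin\mathrm{pos}_{\mathcal{D}^\#}(s)$, $m=\mathsf{true}$; (irr) $t_j=\flat_{\uparrow\pi}(s[\flat(r_j)\sigma]_\pi)$ if $\pi\notin\mathrm{pos}_{\mathcal{D}^\#}(s)$, $m=\mathsf{false}$. A $\mathcal{P}$-chain tree (CT) is $\mathfrak{T}=(V,E,L,V_P)$: (1) $(V,E)$ a (possibly infinite) directed tree, $V\neq\emptyset$, every node with finitely many children; (2) $L$ labels each node $v$ with $(p_v,t_v)\in(0,1]\times\mathcal{T}(\Sigma^\#,\mathcal{V})$,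 $p_v=1$ at the root; (3) $V_P$ is a set of inner nodes, $V_R$ the remaining inner nodes; (4) if $v\in V_P$ has children $w_1,\dots,w_k$ then $t_v\hookrightarrow_{\mathcal{P}}\{\frac{p_{w_1}}{p_v}:t_{w_1},\dots,\frac{p_{w_k}}{p_v}:t_{w_k}\}$ by case (pr) or (p); (5) likewise for $v\in V_R$ by case (r) or (irr); (6) every infinite path contains infinitely many nodes of $V_P$. $|\mathfrak{T}|_{\mathtt{Leaf}}$ is the sum of $p_v$ over all leaves. $\mathcal{P}$ is iAST if $|\mathfrak{T}|_{\mathtt{Leaf}}=1$ for every $\mathcal{P}$-CT. Narrowing substitutions: $\mathrm{vr}(\mathcal{P})$ is a variable-renamed copy of $\mathcal{P}$ with fresh variables. For a term $s\trianglelefteq_\# r_i$ (of the ADP $\ell\to\{p_1:r_1,\dots,p_k:r_k\}^m$), a substitution $\delta$ is a narrowing substitution of $s$ if there are a position $\tau$ of $s$ and an ADP $\ell'\to\dots\in\mathrm{vr}(\mathcal{P})$ such that $\delta$ is an mgu of $s|_\tau$ and $\ell'$ with $\ell\delta,\ell'\delta\in\mathtt{ANF}_{\mathcal{P}}$. A term $s\trianglelefteq_\# r_i$ is captured by $\delta_1,\dots,\delta_d$ if for every narrowing substitution $\rho$ of $s$ there is $1\le e\le d$ and a substitution $\rho'$ with $\rho=\delta_e\rho'$. $\mathrm{capt}_i(\delta_1,\dots,\delta_d)$ is the set of all positions $\pi\in\mathrm{pos}_{\mathcal{D}^\#}(r_i)$ such that $\flat(r_i|_\pi)$ is not captured by $\delta_1,\dots,\delta_d$.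 *)

(* Defs.v *)
From Stdlib Require Import List Permutation.
From HB Require Import structures.
From mathcomp Require Import all_boot all_order all_algebra.
From mathcomp Require Import all_classical all_reals all_analysis.

Set Implicit Arguments.
Unset Strict Implicit.
Unset Printing Implicit Defensive.

Import Order.TTheory GRing.Theory Num.Theory.
Local Open Scope classical_set_scope.
Local Open Scope ring_scope.

Inductive term (F : Type) (ar : F -> nat) (V : Type) : Type :=
| Var of V
| App (f : F) of ('I_(ar f) -> term ar V).

Arguments Var {F ar V}.
Arguments App {F ar V} f _.

Definition position := seq nat.

Section Terms.
Variables (F : Type) (ar : F -> nat) (V : Type).
Local Notation term := (term ar V).

Fixpoint vars (t : term) : set V :=
  match t with
  | Var x => [set x]
  | App f a => [set x | exists i, vars (a i) x]
  end.

Fixpoint subst (s : V -> term) (t : term) : term :=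
  match t with
  | Var x => s x
  | App f a => App f (fun i => subst s (a i))
  end.

Fixpoint subterm_at (t : term) (pi : position) : option term :=
  match pi, t with
  | [::], _ => Some t
  | i :: pi', App f a => if insub i is Some j then subterm_at (a j) pi' else None
  | _ :: _, Var _ => None
  end.

(* Leaves [t] unchanged when [pi] is not a position of [t]. *)
Fixpoint replace_at (t : term) (pi : position) (u : term) : term :=
  match pi, t with
  | [::], _ => u
  | i :: pi', App f a =>
      App f (fun j => if nat_of_ord j == i then replace_at (a j) pi' u else a j)
  | _ :: _, Var x => Var x
  end.

(* The first argument is applied first. *)
Definition comp_subst (s1 s2 : V -> term) : V -> term := fun x => subst s2 (s1 x).

Definition more_general (s1 s2 : V -> term) : Prop :=
  exists s' : V -> term, s2 =1 comp_subst s1 s'.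

Definition mgu (s : V -> term) (t u : term) : Prop :=
  subst s t = subst s u /\
  forall s', subst s' t = subst s' u -> more_general s s'.

(* Most general unifiers are only determined up to this equivalence. *)
Definition equi_general (s1 s2 : V -> term) : Prop :=
  more_general s1 s2 /\ more_general s2 s1.

End Terms.

Record signature := Signature {
  dsym : finType;
  csym : finType;
  arity : dsym + csym -> nat }.

(* [inr f] is the annotated symbol f^#. *)
Definition asym (Sig : signature) : Type := (dsym Sig + csym Sig) + dsym Sig.

Definition aarity (Sig : signature) (f : asym Sig) : nat :=
  match f with
  | inl g => arity g
  | inr g => arity (inl g)
  end.

Section Annotations.
Variables (Sig : signature) (V : Type).

Definition pterm := term (@arity Sig) V.
Definition aterm := term (@aarity Sig) V.

Fixpoint plain (t : pterm) : aterm :=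
  match t with
  | Var x => Var x
  | App f a => @App _ (@aarity Sig) V (inl f) (fun i => plain (a i))
  end.

Fixpoint flat (t : aterm) : pterm :=
  match t with
  | Var x => Var x
  | App f a =>
      match f return ('I_(aarity f) -> pterm) -> pterm with
      | inl g => fun b => App g b
      | inr g => fun b => @App _ (@arity Sig) V (inl g) b
      end (fun i => flat (a i))
  end.

Fixpoint annotate (Phi : set position) (t : pterm) : aterm :=
  match t with
  | Var x => Var x
  | App f a =>
      match f return ('I_(arity f) -> aterm) -> aterm with
      | inl g => fun b =>
          if [::] \in Phi then @App _ (@aarity Sig) V (inr g) b
          else @App _ (@aarity Sig) V (inl (inl g)) b
      | inr g => fun b => @App _ (@aarity Sig) V (inl (inr g)) b
      end (fun i => annotate [set pi | Phi (nat_of_ord i :: pi)] (a i))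
  end.

Definition reannotate (Phi : set position) (t : aterm) : aterm :=
  annotate Phi (flat t).

Fixpoint flat_above (pi : position) (t : aterm) : aterm :=
  match pi, t with
  | i :: pi', App f a =>
      match f return ('I_(aarity f) -> aterm) -> aterm with
      | inl g => fun b => @App _ (@aarity Sig) V (inl g) b
      | inr g => fun b => @App _ (@aarity Sig) V (inl (inl g)) b
      end (fun j => if nat_of_ord j == i then flat_above pi' (a j) else a j)
  | _, _ => t
  end.

Definition asubst (s : V -> pterm) (t : aterm) : aterm :=
  subst (fun x => plain (s x)) t.

Definition root_annotated (t : aterm) : bool :=
  if t is App (inr _) _ then true else false.

Definition root_defined (t : aterm) : bool :=
  match t with
  | App (inr _) _ | App (inl (inl _)) _ => true
  | _ => false
  end.

Definition annotated_subterm (t : pterm) (s : aterm) : Prop :=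
  exists pi u, [/\ subterm_at s pi = Some u, root_annotated u & t = flat u].

End Annotations.

Section ADP.
Variables (R : realType) (Sig : signature) (V : Type).
Local Notation pterm := (pterm Sig V).
Local Notation aterm := (aterm Sig V).

(* Multisets are represented by lists, considered up to [Permutation]. *)
Definition is_multidist (A : Type) (mu : seq (R * A)) : Prop :=
  (forall q, In q mu -> 0 < q.1 <= 1) /\ \sum_(q <- mu) q.1 = 1.

Record adp := Adp {
  lhs : pterm;
  rhs : seq (R * aterm);
  flag : bool }.

Definition adp_equiv (a b : adp) : Prop :=
  [/\ lhs a = lhs b, Permutation (rhs a) (rhs b) & flag a = flag b].

Definition wf_adp (a : adp) : Prop :=
  [/\ root_defined (plain (lhs a)), is_multidist (rhs a) &
      forall q, In q (rhs a) -> vars q.2 `<=` vars (lhs a)].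

Definition adp_problem (P : set adp) : Prop :=
  finite_set P /\ (forall a, P a -> wf_adp a).

Definition subst_adp (s : V -> pterm) (a : adp) : adp :=
  Adp (subst s (lhs a)) [seq (q.1, asubst s q.2) | q <- rhs a] (flag a).

Definition normal_form (P : set adp) (t : aterm) : Prop :=
  forall pi u, subterm_at (flat t) pi = Some u ->
    ~ exists a s, P a /\ u = subst s (lhs a).

Definition ANF (P : set adp) : set aterm :=
  [set t | forall pi u, pi <> [::] -> subterm_at t pi = Some u -> normal_form P u].

Variant rcase := case_pr | case_p | case_r | case_irr.

Definition rcase_of (annotated m : bool) : rcase :=
  match annotated, m with
  | true, true => case_pr
  | true, false => case_p
  | false, true => case_r
  | false, false => case_irr
  end.

Definition contractum (c : rcase) (s : aterm) (pi : position)
    (sigma : V -> pterm) (r : aterm) : aterm :=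
  match c with
  | case_pr => replace_at s pi (asubst sigma r)
  | case_p => flat_above pi (replace_at s pi (asubst sigma r))
  | case_r => replace_at s pi (asubst sigma (plain (flat r)))
  | case_irr => flat_above pi (replace_at s pi (asubst sigma (plain (flat r))))
  end.

Definition rewrites (P : set adp) (c : rcase) (s : aterm) (mu : seq (R * aterm)) : Prop :=
  exists (a : adp) (sigma : V -> pterm) (pi : position) (u : aterm),
    [/\ P a,
        subterm_at s pi = Some u /\ root_defined u,
        flat u = subst sigma (lhs a) /\ ANF P (plain (subst sigma (lhs a))),
        c = rcase_of (root_annotated u) (flag a)
      & Permutation mu [seq (q.1, contractum c s pi sigma q.2) | q <- rhs a]].

Definition directed_tree (N : choiceType) (E : rel N) (root : N) : Prop :=
  forall v : N, exists! s : seq N, path E root s /\ last root s = v.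

Definition inner (N : choiceType) (E : rel N) : set N := [set v | exists w, E v w].

Definition leaf (N : choiceType) (E : rel N) : set N := [set v | forall w, ~~ E v w].

Definition is_children (N : choiceType) (E : rel N) (v : N) (ws : seq N) : Prop :=
  uniq ws /\ forall w, (w \in ws) = E v w.

(* Label of node [v] is [(pr v, tm v)]; the inner nodes outside [VP] form V_R. *)
Record chain_tree (P : set adp) (N : choiceType) (E : rel N)
    (pr : N -> R) (tm : N -> aterm) (VP : set N) : Prop := ChainTree {
  ct_tree : exists root, directed_tree E root /\ pr root = 1;
  ct_finite : forall v, finite_set [set w | E v w];
  ct_prob : forall v, 0 < pr v <= 1;
  ct_inner : VP `<=` inner E;
  ct_P : forall v ws, VP v -> is_children E v ws ->
    exists2 c, c = case_pr \/ c = case_p &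
      rewrites P c (tm v) [seq (pr w / pr v, tm w) | w <- ws];
  ct_R : forall v ws, inner E v -> ~ VP v -> is_children E v ws ->
    exists2 c, c = case_r \/ c = case_irr &
      rewrites P c (tm v) [seq (pr w / pr v, tm w) | w <- ws];
  ct_inf : forall f : nat -> N, (forall n, E (f n) (f n.+1)) ->
    forall n, exists2 n', (n <= n')%N & VP (f n') }.

Definition leaf_mass (N : choiceType) (E : rel N) (pr : N -> R) : \bar R :=
  (\esum_(v in leaf E) (pr v)%:E)%E.

Definition iAST (P : set adp) : Prop :=
  forall (N : choiceType) (E : rel N) (pr : N -> R) (tm : N -> aterm) (VP : set N),
    chain_tree P E pr tm VP -> leaf_mass E pr = 1%E.

(* By [wf_adp], every variable of an ADP occurs in its left-hand side. *)
Definition renamed_copy (P Q : set adp) : Prop :=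
  exists xi : adp -> V -> V,
    [/\ forall a, P a -> injective (xi a),
        Q = [set subst_adp (fun x => Var (xi a x)) a | a in P] &
        forall a b, P a -> Q b -> vars (lhs a) `&` vars (lhs b) = set0].

(* [Q] stands for vr(P), and [l] for the left-hand side of the ADP that has [s]
   among its annotated subterms. *)
Definition narrowing_subst (P Q : set adp) (l s : pterm) (delta : V -> pterm) : Prop :=
  exists (tau : position) (u : pterm) (b : adp),
    [/\ subterm_at s tau = Some u, Q b, mgu delta u (lhs b),
        ANF P (plain (subst delta l)) & ANF P (plain (subst delta (lhs b)))].

Definition captured (P Q : set adp) (l : pterm) (d : nat) (delta : 'I_d -> V -> pterm)
    (s : pterm) : Prop :=
  forall rho, narrowing_subst P Q l s rho -> exists e, more_general (delta e) rho.

Definition capt (P Q : set adp) (l : pterm) (d : nat) (delta : 'I_d -> V -> pterm)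
    (r : aterm) : set position :=
  [set pi | exists u, [/\ subterm_at r pi = Some u, root_annotated u &
                          ~ captured P Q l delta (flat u)]].

(* d is finite, so "all narrowing substitutions of s" is read up to the renaming
   ambiguity of most general unifiers. *)
Definition all_narrowing_substs (P Q : set adp) (l s : pterm) (d : nat)
    (delta : 'I_d -> V -> pterm) : Prop :=
  (forall e, narrowing_subst P Q l s (delta e)) /\
  (forall rho, narrowing_subst P Q l s rho -> exists e, equi_general (delta e) rho).

End ADP.

(* Main.v *)
(** Both problems have the same normal forms, since [l] remains a left-hand side,
    so a chain tree for one problem is turned into a chain tree for the other by
    relabelling terms on the same weighted tree; the leaf mass does not change.
    A step with an instance [l delta_e] is a step with [l], and from [P' U N] to
    [P] one only gains annotations, hence only gains nodes of [VP].
    From [P] to [P' U N], a step with [l] and [sigma] is a step with [l delta_e]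
    whenever [sigma] factors through [delta_e] on the variables of [l]; otherwise
    the captured subterms, which lose their annotations, are normal forms under
    [sigma], so that the lost annotations are never used. *)
Require Import Defs.
From Stdlib Require Import List Permutation.
From mathcomp Require Import all_boot all_order all_algebra.
From mathcomp Require Import all_classical all_reals all_analysis.
Local Open Scope classical_set_scope.

(** * Terms, positions and substitutions *)

Section Terms.
Context {F : Type} {ar : F -> nat} {V : Type}.
Local Notation term := (term ar V).
Implicit Types (t u w : term) (s : V -> term).

Lemma subterm_at0 t : subterm_at t [::] = Some t. Proof. by case: t. Qed.

Lemma subterm_at_arg f (a : 'I_(ar f) -> term) (i : 'I_(ar f)) pi :
  subterm_at (App f a) (val i :: pi) = subterm_at (a i) pi.
Proof. by rewrite /= valK. Qed.

Lemma subterm_at_consP f (a : 'I_(ar f) -> term) n pi w :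
  subterm_at (App f a) (n :: pi) = Some w ->
  exists i : 'I_(ar f), n = val i /\ subterm_at (a i) pi = Some w.
Proof. by rewrite /=; case: insubP => // i _ <- ?; exists i. Qed.

Lemma subterm_at_cat t pi rho u :
  subterm_at t pi = Some u -> subterm_at t (pi ++ rho) = subterm_at u rho.
Proof.
elim: pi t => [|n pi IH] [x|f a] //=; try by case=> <-.
by case: insubP => // i _ _; apply: IH.
Qed.

(** The arguments are read back through [subterm_at], so that no equality of dependent pairs has to
    be inverted. *)
Lemma App_inj_arg f (a b : 'I_(ar f) -> term) : App f a = App f b -> a = b.
Proof.
move=> e; apply/funext => i.
have := subterm_at_arg _ b i [::]; rewrite -e subterm_at_arg !subterm_at0.
by case.
Qed.

Lemma eq_subst s s' t : (forall x, vars t x -> s x = s' x) -> subst s t = subst s' t.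
Proof.
elim: t => [x|f a IH] /= e; first exact: e.
by congr App; apply/funext => i; apply: IH => x xi; apply: e; exists i.
Qed.

Lemma subst_comp s s' t : subst s' (subst s t) = subst (comp_subst s s') t.
Proof. by elim: t => [x|f a IH] //=; congr App; apply/funext. Qed.

Lemma subst_Var t : subst Var t = t.
Proof. by elim: t => [x|f a IH] //=; congr App; apply/funext. Qed.

Lemma more_general_trans s s' s'' :
  more_general s s' -> more_general s' s'' -> more_general s s''.
Proof.
move=> [a sa] [b sb]; exists (comp_subst a b) => x.
by rewrite sb /comp_subst sa /comp_subst subst_comp.
Qed.

Lemma vars_subterm t pi u : subterm_at t pi = Some u -> vars u `<=` vars t.
Proof.
elim: pi t => [|n pi IH] t; first by case: t => [x|f a] [<-].
by case: t => [//|f a] /subterm_at_consP[i [_ /IH ui]] x /ui xi; exists i.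
Qed.

Lemma vars_subterm_at t x : vars t x -> exists pi, subterm_at t pi = Some (Var x).
Proof.
elim: t => [y|f a IH] /=; first by move=> ->; exists [::].
by move=> [i /IH[pi e]]; exists (val i :: pi); rewrite /= valK.
Qed.

Lemma vars_renamed (xi : V -> V) t x :
  vars t x -> vars (subst (fun x => Var (xi x)) t) (xi x).
Proof.
elim: t => [y|f a IH] /=; first by move=> ->.
by move=> [i /IH ?]; exists i.
Qed.

Lemma subterm_at_subst s t pi u :
  subterm_at t pi = Some u -> subterm_at (subst s t) pi = Some (subst s u).
Proof.
elim: pi t => [|n pi IH] t; first by case: t => [x|f a] [<-] //=; case: (s x).
case: t => [//|f a] /subterm_at_consP[i [-> /IH e]].
by rewrite [subst _ _]/= subterm_at_arg.
Qed.

Lemma subterm_at_substP s t pi w : subterm_at (subst s t) pi = Some w ->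
  (exists2 u, subterm_at t pi = Some u & w = subst s u) \/
  (exists x rho, vars t x /\ subterm_at (s x) rho = Some w).
Proof.
elim: pi t => [|n pi IH] [x|f a].
- by move=> e; right; exists x, [::].
- by case=> <-; left; exists (App f a).
- by move=> e; right; exists x, (n :: pi).
move=> /subterm_at_consP[i [-> /IH[[u ui ->]|[x [rho [xi e]]]]]].
  by left; exists u => //; rewrite subterm_at_arg.
by right; exists x, rho; split => //; exists i.
Qed.

(** * Existence of most general unifiers *)

Fixpoint term_size t : nat :=
  match t with
  | Var _ => 1
  | App f a => (\sum_(i < ar f) term_size (a i)).+1
  end.

Lemma term_size_gt0 t : 0 < term_size t. Proof. by case: t. Qed.

Lemma term_size_vars s t x : vars t x -> term_size (s x) <= term_size (subst s t).
Proof.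
elim: t => [y|f a IH] /=; first by move=> ->.
move=> [i /IH]/leq_trans; apply; rewrite ltnW// ltnS (bigD1 i)//=.
exact: leq_addr.
Qed.

(** If [x] occurred strictly below the root of [t], the instance of [t] would be larger than
    [s x]. *)
Lemma occurs_check s t x : vars t x -> s x = subst s t -> t = Var x.
Proof.
case: t => [y -> //|f a] /= [i xi] e.
have := term_size_vars s _ _ xi; rewrite e /= (bigD1 i)//=.
by rewrite ltnNge leq_addr.
Qed.

Fixpoint unifies s (E : seq (term * term)) : Prop :=
  match E with
  | [::] => True
  | (t, u) :: E' => subst s t = subst s u /\ unifies s E'
  end.

Definition list_mgu s (E : seq (term * term)) : Prop :=
  unifies s E /\ forall s', unifies s' E -> more_general s s'.

(** Measuring left sides suffices: under a unifier both sides of an equation have the same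
    instance. *)
Definition instance_size s (E : seq (term * term)) : nat :=
  \sum_(q <- E) term_size (subst s q.1).

Definition subst_eqs s (E : seq (term * term)) : seq (term * term) :=
  [seq (subst s q.1, subst s q.2) | q <- E].

Lemma unifies_subst_eqs s s' E : unifies s' (subst_eqs s E) <-> unifies (comp_subst s s') E.
Proof. by elim: E => [|[t u] E IH] //=; rewrite !subst_comp IH. Qed.

Lemma unifies_cat s E E' : unifies s (E ++ E') <-> unifies s E /\ unifies s E'.
Proof. by elim: E => [|[t u] E IH] /=; [tauto|rewrite IH; tauto]. Qed.

Lemma unifies_args s n (a b : 'I_n -> term) :
  unifies s [seq (a i, b i) | i <- enum 'I_n] <->
  (forall i, subst s (a i) = subst s (b i)).
Proof.
have aux js : unifies s [seq (a i, b i) | i <- js] <->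
    (forall i, i \in js -> subst s (a i) = subst s (b i)).
  elim: js => [|i js IH] //=; rewrite IH; split.
    by move=> [e es] i'; rewrite inE => /predU1P[->|/es].
  move=> es; split; first by apply: es; rewrite mem_head.
  by move=> i' ij; apply: es; rewrite inE ij orbT.
by rewrite aux; split => // es i; apply: es; rewrite mem_enum.
Qed.

(** A unifier [s'] of [Var x] and [t] absorbs the replacement [th] of [x] by [t], that is,
    [comp_subst th s' = s']. Hence it also unifies the equations after [th], and it factors through
    [comp_subst th s]. *)
Lemma list_mgu_eliminate x t s E :
  ~ vars t x ->
  list_mgu s (subst_eqs (fun y => if pselect (y = x) then t else Var y) E) ->
  exists s', list_mgu s' ((Var x, t) :: E).
Proof.
set th := fun y => _; move=> nxt [sE sgen].
have thx : th x = t by rewrite /th; case: pselect.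
have tht : subst th t = t.
  rewrite -[RHS]subst_Var; apply: eq_subst => y yt; rewrite /th.
  by case: pselect => // yx; rewrite yx in yt.
exists (comp_subst th s); split => /=.
  split; last exact/unifies_subst_eqs.
  by rewrite -subst_comp tht /comp_subst thx.
move=> s' /= [s'xt s'E].
have ths' : comp_subst th s' = s'.
  apply/funext => y; rewrite /comp_subst /th.
  by case: pselect => //= ->.
have [|s'' es''] := sgen s'; first by apply/unifies_subst_eqs; rewrite ths'.
exists s'' => y; rewrite -[in LHS]ths' /comp_subst subst_comp.
by congr (subst _ _); apply/funext => z; rewrite es''.
Qed.

Lemma list_mgu_swap s t u E : list_mgu s ((t, u) :: E) -> list_mgu s ((u, t) :: E).
Proof.
by move=> [[/= ? ?] sgen]; split => //= s' [? ?]; apply: sgen.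
Qed.

(* Descends on the size of the instance of the equations under the given
   unifier, which variable elimination leaves unchanged. *)
Lemma list_mgu_exists s0 E : unifies s0 E -> exists s, list_mgu s E.
Proof.
have [n] := ubnP (instance_size s0 E); elim: n E => // n IH [|[t u] E].
  move=> _ _; exists Var; split => // s _; exists s => x.
  by rewrite /comp_subst.
rewrite /instance_size big_cons ltnS /= => szE [e sE].
(* Stated for a variable on the left; a variable on the right is handled by swapping the equation,
   as both sides have the same instance size. *)
have elim_var x v : term_size (subst s0 v) + instance_size s0 E <= n ->
    s0 x = subst s0 v -> exists s, list_mgu s ((Var x, v) :: E).
  move=> sz ex; have [->|vx] := pselect (v = Var x).
    have [|//|s [s1 s2]] := IH E.
      by apply: leq_trans sz; rewrite -add1n leq_add2r term_size_gt0.
    by exists s; split => // s' [_ /s2].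
  have nx : ~ vars v x by move=> /occurs_check/(_ ex).
  set th := (fun y => if pselect (y = x) then v else Var y).
  have ths : comp_subst th s0 = s0.
    by apply/funext => y; rewrite /comp_subst /th; case: pselect => //= ->.
  have [||s sm] := IH (subst_eqs th E).
  - apply: leq_trans sz; rewrite -add1n.
    rewrite (_ : instance_size _ _ = instance_size s0 E) ?leq_add2r ?term_size_gt0//.
    rewrite /instance_size big_map; apply: eq_bigr => q _ /=.
    by rewrite subst_comp ths.
  - by apply/unifies_subst_eqs; rewrite ths.
  - exact: list_mgu_eliminate sm.
case: t e szE => [x|f a] e szE; first by apply: elim_var; rewrite // -e.
case: u e => [x|g b] e.
  have [||s sm] := elim_var x (App f a) => //.
  by exists s; apply: list_mgu_swap.
have efg : f = g by case: e.
subst g; have {}e := App_inj_arg _ _ _ e.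
(* Decomposition: the common root symbol counts one in the size, so the measure decreases. *)
have [||s [s1 s2]] := IH ([seq (a i, b i) | i <- enum 'I_(ar f)] ++ E).
- apply: leq_trans szE; rewrite /instance_size big_cat /= big_map addSn ltnS.
  by rewrite big_enum.
- apply/unifies_cat; split => //; apply/unifies_args => i.
  by have := congr1 (fun h => h i) e.
exists s; split.
  move/unifies_cat: s1 => [/unifies_args es sE'] /=; split => //.
  by congr App; apply/funext.
move=> s' /= [/App_inj_arg es' s'E]; apply: s2; apply/unifies_cat; split => //.
by apply/unifies_args => i; have := congr1 (fun h => h i) es'.
Qed.

Lemma mgu_exists s0 t u : subst s0 t = subst s0 u -> exists s, mgu s t u.
Proof.
move=> e; have [|s [[/= su _] sgen]] := list_mgu_exists s0 [:: (t, u)]; first by [].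
by exists s; split => // s' e'; apply: sgen.
Qed.

End Terms.

(** * Removal of annotations *)

Section Annotations.
Context {Sig : signature} {V : Type}.
Local Notation pterm := (pterm Sig V).
Local Notation aterm := (aterm Sig V).
Implicit Types (t u : aterm) (s : V -> pterm) (Q : pterm -> Prop).

Lemma flat_plain (t : pterm) : flat (plain t) = t.
Proof. by elim: t => [x|f a IH] //=; congr App; apply/funext. Qed.

Lemma flat_asubst s t : flat (asubst s t) = subst s (flat t).
Proof.
elim: t => [x|[g|g] a IH] /=; first exact: flat_plain;
  by congr App; apply/funext.
Qed.

Lemma plain_subst s (t : pterm) : asubst s (plain t) = plain (subst s t).
Proof. by elim: t => [x|f a IH] //=; congr App; apply/funext. Qed.

Lemma asubst_comp s s' t : asubst s' (asubst s t) = asubst (comp_subst s s') t.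
Proof.
rewrite /asubst subst_comp; congr subst; apply/funext => x.
exact: plain_subst.
Qed.

Lemma eq_asubst s s' t : (forall x, vars t x -> s x = s' x) -> asubst s t = asubst s' t.
Proof. by move=> e; apply: eq_subst => x /e ->. Qed.

Lemma vars_flat t : vars (flat t) = vars t.
Proof.
elim: t => [x|[g|g] a IH] //=; apply/seteqP; split => x /= [i ix]; exists i;
  by move: ix; rewrite IH.
Qed.

Lemma subterm_at_flat t pi : subterm_at (flat t) pi = omap (@flat _ _) (subterm_at t pi).
Proof.
elim: pi t => [|n pi IH] [x|[g|g] a] //=; by case: insubP.
Qed.

Lemma subterm_at_plain (t : pterm) pi :
  subterm_at (plain t) pi = omap (@plain _ _) (subterm_at t pi).
Proof. by elim: pi t => [|n pi IH] [x|f a] //=; case: insubP. Qed.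

Lemma root_defined_flat t : root_defined t = root_defined (plain (flat t)).
Proof. by case: t => [x|[[g|g]|g] a]. Qed.

(** The relation behind both simulations. For one direction [Q] is the property of being a normal
    form; for the other it is trivial and the two sides are exchanged. *)
Inductive drops Q : aterm -> aterm -> Prop :=
| drops_Var x : drops Q (Var x) (Var x)
| drops_App (f : asym Sig) (a b : 'I_(aarity f) -> aterm) :
    (forall i, drops Q (a i) (b i)) -> drops Q (App f a) (App f b)
| drops_annotation (g : dsym Sig) (a b : 'I_(@arity Sig (inl g)) -> aterm) :
    (forall i, drops Q (a i) (b i)) ->
    Q (@App _ (@arity Sig) V (inl g) (fun i => flat (a i))) ->
    drops Q (@App _ (@aarity Sig) V (inr g) a) (@App _ (@aarity Sig) V (inl (inl g)) b).

Lemma drops_refl Q t : drops Q t t.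
Proof. by elim: t => [x|f a IH]; constructor. Qed.

Lemma flat_drops Q t t' : drops Q t t' -> flat t' = flat t.
Proof.
elim=> [//|[f|f] a b _ IH|g a b _ IH _] /=; congr App; exact/funext.
Qed.

Lemma drops_plain_flat t : drops (fun=> True) t (plain (flat t)).
Proof. by elim: t => [x|[f|f] a IH] /=; constructor. Qed.

Lemma subterm_at_drops Q t t' pi u : drops Q t t' -> subterm_at t pi = Some u ->
  exists2 u', subterm_at t' pi = Some u' & drops Q u u'.
Proof.
move=> tt'; elim: tt' pi u => [x|f a b ab IH|g a b ab IH q] [|n pi] u //.
- by case=> <-; exists (Var x) => //; constructor.
- by case=> <-; exists (App f b) => //; constructor.
- move=> e; have [i [-> ei]] := subterm_at_consP _ _ _ _ _ e.
  have [u2 e2 ?] := IH _ _ _ ei; exists u2 => //.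
  by rewrite subterm_at_arg.
- by case=> <-; eexists => //; constructor.
- move=> e; have [i [-> ei]] := subterm_at_consP _ _ _ _ _ e.
  have [u2 e2 ?] := IH _ _ _ ei; exists u2 => //.
  by rewrite (@subterm_at_arg _ (@aarity Sig) V (inl (inl g)) b i).
Qed.

Lemma root_annotated_drops Q t t' : drops Q t t' ->
  (root_annotated t' -> root_annotated t) /\
  (root_annotated t -> root_annotated t' \/ Q (flat t)).
Proof. by case=> [x|f a b _|g a b _ q] //=; split; auto. Qed.

(** An annotation dropped above [pi] must satisfy [Q] again after the replacement, which the first
    hypothesis grants. That hypothesis holds vacuously if [Q] means normal form and [flat u] is a
    redex, and trivially if [Q] is always true. *)
Lemma drops_replace_at Q t t' pi u v v' :
  (forall w rho w', Q w -> subterm_at w rho = Some (flat u) -> Q w') ->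
  drops Q t t' -> drops Q v v' -> subterm_at t pi = Some u ->
  drops Q (replace_at t pi v) (replace_at t' pi v').
Proof.
move=> Qu tt' vv'; elim: tt' pi => [x|f a b ab IH|g a b ab IH q] [|n pi] //=.
  by case: insubP => // i _ <- e; constructor => j; case: eqP => // /val_inj ->; apply: IH.
case: insubP => // i _ <- e; constructor.
  by move=> j; case: eqP => // /val_inj ->; apply: IH.
apply: (Qu _ (val i :: pi) _ q).
by rewrite subterm_at_arg subterm_at_flat e.
Qed.

Lemma drops_flat_above Q pi t t' :
  drops Q t t' -> drops Q (flat_above pi t) (flat_above pi t').
Proof.
move=> tt'; elim: tt' pi => [x|f a b ab IH|g a b ab IH q] [|n pi] //=;
  try by constructor.
- by case: f a b ab IH => f a b ab IH; constructor => j; case: eqP.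
- by constructor => j; case: eqP.
Qed.

Lemma drops_asubst Q s t t' :
  drops (fun w => Q (subst s w)) t t' -> drops Q (asubst s t) (asubst s t').
Proof.
elim=> [x|f a b _ IH|g a b _ IH q]; first exact: drops_refl; constructor => //.
have -> : (fun i => flat (asubst s (a i))) = (fun i => subst s (flat (a i))).
  by apply/funext => i; rewrite flat_asubst.
exact: q.
Qed.

Lemma drops_reannotate Q (Phi : set position) t :
  (forall pi, Phi pi -> exists2 u, subterm_at t pi = Some u & root_annotated u) ->
  (forall pi u, subterm_at t pi = Some u -> root_annotated u -> ~ Phi pi -> Q (flat u)) ->
  drops Q t (reannotate Phi t).
Proof.
rewrite /reannotate; elim: t Phi => [x|f a IH] Phi PhiA nPhi /=; first by constructor.
have args i : drops Q (a i) (annotate [set pi | Phi (nat_of_ord i :: pi)] (flat (a i))).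
  apply: IH => [pi /PhiA [u]|pi u e].
    by rewrite (subterm_at_arg f a i) => ? ?; exists u.
  by apply: nPhi; rewrite (subterm_at_arg f a i).
case: f a IH args PhiA nPhi => [[f|f]|f] a IH args PhiA nPhi /=.
- case: ifPn => [/set_mem/PhiA[u [<-]]//|_]; exact: drops_App.
- exact: drops_App.
- case: ifPn => [_|]; first exact: (@drops_App _ (inr f)).
  move=> /negP nP; apply: drops_annotation => //.
  by apply: (nPhi [::] _ erefl) => // ?; apply: nP; rewrite inE.
Qed.

End Annotations.

(** * Lists related entry by entry *)

Section Lists.
Context {A B : Type}.

Lemma Forall2_map_seq (T : Type) (rel : A -> B -> Prop) (f : T -> A) (g : T -> B) (xs : seq T) :
  (forall x, rel (f x) (g x)) -> Forall2 rel [seq f x | x <- xs] [seq g x | x <- xs].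
Proof. by move=> fg; elim: xs => [|x xs IH] /=; constructor. Qed.

Lemma Forall2_map_impl (A' B' : Type) (rel : A -> B -> Prop) (rel' : A' -> B' -> Prop)
    (f : A -> A') (g : B -> B') xs ys :
  (forall x y, rel x y -> rel' (f x) (g y)) -> Forall2 rel xs ys ->
  Forall2 rel' [seq f x | x <- xs] [seq g y | y <- ys].
Proof. by move=> fg; elim=> [|x y xs' ys' xy _ IH] /=; constructor => //; apply: fg. Qed.

(** Turns a list of new labels for the children of a node into a function on nodes. The default [g0]
    is the function for the empty list. *)
Lemma Forall2_uniq_fun (T : eqType) (rel : A -> B -> Prop) (f : T -> A) (g0 : T -> B)
    (xs : seq T) ys : uniq xs -> Forall2 rel [seq f x | x <- xs] ys ->
  exists2 g : T -> B, ys = [seq g x | x <- xs] & forall x, x \in xs -> rel (f x) (g x).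
Proof.
elim: xs ys => [|x xs IH] ys /=; first by move=> _ H; inversion H; exists g0.
move=> /andP[xxs uxs] H; inversion H; subst.
have [g -> gP] := IH _ uxs H4.
exists (fun z => if z == x then y else g z).
  congr cons; first by rewrite eqxx.
  by apply/eq_in_map => z zxs; case: eqP => // zx; rewrite -zx zxs in xxs.
by move=> z; rewrite inE; case: eqP => [->|_ /gP].
Qed.

End Lists.

(** * Redexes, normal forms and captured terms *)

Section Rewriting.
Context {R : realType} {Sig : signature} {V : Type}.
Local Notation pterm := (pterm Sig V).
Local Notation aterm := (aterm Sig V).
Local Notation adp := (adp R Sig V).
Implicit Types (P Q : set adp) (s : V -> pterm).

Definition redex P (w : pterm) : Prop := exists a s, P a /\ w = subst s (lhs a).

Definition plain_normal_form P (w : pterm) : Prop :=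
  forall pi u, subterm_at w pi = Some u -> ~ redex P u.

Lemma plain_normal_form_subterm P w pi u :
  plain_normal_form P w -> subterm_at w pi = Some u -> plain_normal_form P u.
Proof. by move=> nf e rho v; rewrite -(subterm_at_cat _ _ _ _ e); apply: nf. Qed.

Lemma ANF_plainP P (t : pterm) : ANF P (plain t) <->
  forall pi u, pi <> [::] -> subterm_at t pi = Some u -> ~ redex P u.
Proof.
split=> [anf pi u pi0 e|nf pi u' pi0].
  apply: (anf pi (plain u) pi0 _ [::] u); first by rewrite subterm_at_plain e.
  by rewrite flat_plain subterm_at0.
rewrite subterm_at_plain; case e: subterm_at => [u|//] [<-] rho w.
rewrite flat_plain -(subterm_at_cat _ _ _ _ e); apply: nf.
by case: pi pi0 {e}.
Qed.

Lemma eq_ANF P Q : (forall w, redex P w <-> redex Q w) -> ANF P = ANF Q.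
Proof.
move=> PQ; apply/seteqP; split=> t nf pi u pi0 e rho w ew /PQ;
  exact: (nf pi u pi0 e rho w ew).
Qed.

(** A redex in the more general instance stays a redex, at the same position, under further
    instantiation. *)
Lemma ANF_more_general P s s' (t : pterm) :
  more_general s s' -> ANF P (plain (subst s' t)) -> ANF P (plain (subst s t)).
Proof.
move=> [b sb] /ANF_plainP nf; apply/ANF_plainP => pi u pi0 e [a [c [Pa uc]]].
apply: (nf pi (subst b u) pi0).
  rewrite (_ : subst s' t = subst b (subst s t)); first exact: subterm_at_subst.
  by rewrite subst_comp; congr subst; apply/funext.
by exists a, (comp_subst c b); split => //; rewrite uc subst_comp.
Qed.

(** By induction on [t]: either some argument contains a redex, or the only redex is at the root and
    all proper subterms are normal. *)
Lemma innermost_redex P (t : pterm) pi u : subterm_at t pi = Some u -> redex P u ->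
  exists rho w, [/\ subterm_at t rho = Some w, redex P w & ANF P (plain w)].
Proof.
elim: t pi u => [x|f a IH] pi u e ru.
  exists [::], (Var x); split => //; first by case: pi e => // -[->].
  by apply/ANF_plainP => -[|].
have [[i [rho [w [ew rw]]]]|nex] :=
    pselect (exists i rho w, subterm_at (a i) rho = Some w /\ redex P w).
  have [rho' [w' [e' r' n']]] := IH _ _ _ ew rw.
  by exists (val i :: rho'), w'; split => //; rewrite subterm_at_arg.
exists [::], (App f a); split => //.
  case: pi e => [[->]//|n pi e]; have [i [_ ei]] := subterm_at_consP _ _ _ _ _ e.
  by case: nex; exists i, pi, u.
apply/ANF_plainP => -[//|n rho] w _ ew rw; have [i [_ ei]] := subterm_at_consP _ _ _ _ _ ew.
by apply: nex; exists i, rho, w.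
Qed.

(* The first redex inside an instance of a captured term would overlap that
   term properly, and the resulting mgu would be an instance of some [delta e]. *)
Lemma captured_normal_form P Q (l : pterm) d (delta : 'I_d -> V -> pterm) s (t : pterm) :
  renamed_copy P Q -> (exists2 a, P a & lhs a = l) -> (forall x, l <> Var x) ->
  vars t `<=` vars l -> ANF P (plain (subst s l)) -> captured P Q l delta t ->
  ~ (exists e s', forall x, vars l x -> s x = subst s' (delta e x)) ->
  plain_normal_form P (subst s t).
Proof.
move=> [xi [xi_inj QE fresh]] [a0 Pa0 a0l] lVar tl anf capt ninst pi0 u0 e0 r0.
have [pi [w [ew [a [rho [Pa wE]]] anfw]]] := innermost_redex _ _ _ _ e0 r0.
have [[u eu wu]|[x [pi1 [xt e1]]]] := subterm_at_substP _ _ _ _ ew; last first.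
  (* A redex inside the instance of a variable [x] of [t] would also occur strictly below the root
     of [subst s l], since [x] occurs in [l] and [l] is not a variable. *)
  have [pi2 e2] := vars_subterm_at _ _ (tl _ xt).
  have := proj1 (ANF_plainP _ _) anf (pi2 ++ pi1) w.
  apply.
  - case: pi2 e2 => //; case: (l) (lVar x) => [y nyx [yx]|f b //].
    by rewrite yx in nyx.
  - by rewrite (subterm_at_cat _ _ _ _ (subterm_at_subst s _ _ _ e2)).
  - by exists a, rho.
set b := subst_adp (fun x => Var (xi a x)) a.
have Qb : Q b by rewrite QE; exists a.
have ul : vars u `<=` vars l by move=> x /(vars_subterm _ _ _ eu)/tl.
have disj x : vars l x -> vars (lhs b) x -> False.
  move=> xl xb; have : (vars l `&` vars (lhs b)) x by [].
  by rewrite -a0l (fresh _ _ Pa0 Qb).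
(* An inverse of the renaming on its range, with arbitrary values elsewhere. *)
have /choice[inv invP] y : exists x, (exists z, y = xi a z) -> y = xi a x.
  have [[z ->]|nz] := pselect (exists z, y = xi a z); first by exists z.
  by exists y.
(* As [l] and [lhs b] share no variables, the matcher [rho] and [s] can be glued to a unifier of [u]
   and [lhs b]. *)
pose tau x := if pselect (vars (lhs b) x) then rho (inv x) else s x.
have tau_l x : vars l x -> tau x = s x.
  by move=> xl; rewrite /tau; case: pselect => // xb; case: (disj _ xl xb).
have tau_b : subst tau (lhs b) = w.
  rewrite /b /= subst_comp wE; apply: eq_subst => x xa; rewrite /comp_subst /= /tau.
  case: pselect => [xb|]; last by case; exact: vars_renamed.
  congr rho; apply: (xi_inj _ Pa); rewrite -invP//; by exists x.
have tau_u : subst tau u = w.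
  by rewrite wu; apply: eq_subst => x /ul/tau_l.
have [del delP] := mgu_exists tau u (lhs b) (etrans tau_u (esym tau_b)).
have deltau : more_general del tau by apply: delP.2; rewrite tau_u.
(* The two [ANF] conditions hold for [tau], hence for the more general [del], which is therefore a
   narrowing substitution of [t]. *)
have [|e e_del] := capt del.
  exists pi, u, b; split => //; apply: (ANF_more_general _ _ _ _ deltau).
    by rewrite (eq_subst tau s).
  by rewrite tau_b.
have [s' es'] := more_general_trans _ _ _ e_del deltau.
by apply: ninst; exists e, s' => x xl; rewrite -tau_l// es'.
Qed.

(** * Rewrite steps and their simulation *)

Definition is_case_P (c : rcase) : Prop := c = case_pr \/ c = case_p.

Lemma is_case_P_rcase_of b m : is_case_P (rcase_of b m) <-> b.
Proof. by case: b m => [] []; split => //; rewrite /is_case_P; [left|right|case|case]. Qed.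

Lemma is_case_R c : ~ is_case_P c -> c = case_r \/ c = case_irr.
Proof. by case: c => nc; auto; case: nc; [left|right]. Qed.

(** Separates the two flags: [b] decides which term is inserted, [m] whether the annotations above
    it survive. *)
Lemma contractumE b m (t : aterm) pi s (r : aterm) :
  contractum (rcase_of b m) t pi s r =
  (if m then id else flat_above pi)
    (replace_at t pi (if b then asubst s r else plain (flat (asubst s r)))).
Proof. by case: b m => [] [] //=; rewrite flat_asubst plain_subst. Qed.

(** The last hypothesis covers two situations: the redex is annotated equally on both sides, or only
    on the left, and then [H] is trivial, so that all annotations of the inserted term may be
    lost. *)
Lemma contractum_drops (H : pterm -> Prop) (b b' m : bool) (t t' : aterm) pi u s s' (r r' : aterm) :
  (forall w rho w', H w -> subterm_at w rho = Some (flat u) -> H w') ->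
  drops H t t' -> subterm_at t pi = Some u -> drops H (asubst s r) (asubst s' r') ->
  b = b' \/ b /\ ~~ b' /\ (forall w, H w) ->
  drops H (contractum (rcase_of b m) t pi s r) (contractum (rcase_of b' m) t' pi s' r').
Proof.
move=> Hu tt' e rr' bb'; rewrite !contractumE.
suff rep : drops H (replace_at t pi (if b then asubst s r else plain (flat (asubst s r))))
    (replace_at t' pi (if b' then asubst s' r' else plain (flat (asubst s' r')))).
  by case: m => //; apply: drops_flat_above.
apply: (drops_replace_at _ _ _ _ _ _ _ Hu tt' _ e).
case: bb' => [<-|[-> [/negbTE -> HT]]].
  by case: b => //; rewrite (flat_drops _ _ _ rr'); apply: drops_refl.
rewrite (flat_drops _ _ _ rr') (_ : H = fun=> True); first exact: drops_plain_flat.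
by apply/funext => w; apply/propext; split => // _.
Qed.

Lemma Permutation_Forall2_lift (T : Type) (rel : T -> T -> Prop) mu nu nu' :
  Permutation mu nu -> Forall2 rel nu nu' ->
  exists2 mu', Permutation mu' nu' & Forall2 rel mu mu'.
Proof.
move=> pm F2; have [mu' [pm' F2']] := Permutation_Forall2 (Permutation_sym pm) F2.
by exists mu' => //; apply: Permutation_sym.
Qed.

Lemma rewrites_perm P c t mu nu : Permutation mu nu -> rewrites P c t mu -> rewrites P c t nu.
Proof.
move=> mn [a [s [pi [u [Pa e1 e2 e3 pm]]]]]; exists a, s, pi, u; split => //.
exact: Permutation_trans (Permutation_sym mn) pm.
Qed.

Lemma uniq_Permutation (T : eqType) (xs ys : seq T) :
  uniq xs -> uniq ys -> xs =i ys -> Permutation xs ys.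
Proof.
elim: xs ys => [|x xs IH] ys /=.
  by move=> _ _; case: ys => [//|y ys] /(_ y); rewrite in_nil mem_head.
move=> /andP[xxs uxs] uys e.
have xys : x \in ys by rewrite -e mem_head.
case/splitPr: xys uys e => p1 p2 uys e.
apply: (@Permutation_trans _ _ (x :: (p1 ++ p2))); last exact: Permutation_middle.
move: uys; rewrite -cat1s uniq_catCA /= => /andP[xp up]; constructor; apply: IH => //.
move=> z; move: (e z); rewrite inE !mem_cat inE; have [->|//] := eqVneq z x.
by rewrite (negbTE xxs) -mem_cat (negbTE xp).
Qed.

Lemma is_children_Permutation (T : choiceType) (E : rel T) v ws ws' :
  is_children E v ws -> is_children E v ws' -> Permutation ws ws'.
Proof.
by move=> [u1 m1] [u2 m2]; apply: uniq_Permutation => // w; rewrite m1 m2.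
Qed.

(** Matching the lists entry by entry allows the tree and its weights to be kept. A step of case (r)
    or (irr) may become one of case (pr) or (p), but not conversely. *)
Definition step_simulation P Q (sim : aterm -> aterm -> Prop) : Prop :=
  forall c t t' mu, sim t t' -> rewrites P c t mu -> exists c' mu',
    [/\ rewrites Q c' t' mu',
        Forall2 (fun q q' => q.1 = q'.1 /\ sim q.2 q'.2) mu mu'
      & is_case_P c -> is_case_P c'].

(* A [P]-chain tree becomes a [Q]-chain tree on the same weighted tree: the
   terms are relabelled from the root downwards, and [VP] can only grow. *)
Lemma iAST_simulation P Q (sim : aterm -> aterm -> Prop) :
  (forall t, sim t t) -> step_simulation P Q sim -> iAST Q -> iAST P.
Proof.
move=> sim_refl simP Qast T E pr tm VP [[root [tree pr_root]] fin prob VPin ctP ctR inf].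
have children v : exists ws, is_children E v ws.
  have /finite_seqP[ws wsE] := fin v; exists (undup ws); split; first exact: undup_uniq.
  move=> w; rewrite mem_undup; apply/idP/idP => [ww|Evw].
    by have : [set` ws] w by []; rewrite -wsE.
  by have : [set w | E v w] w by []; rewrite wsE.
(* For a node [v] relabelled by [u], the pair [gb] holds the new terms of its children and a bit
   telling whether the new step is of case (pr) or (p). *)
pose good v u (gb : (T -> aterm) * bool) :=
  [/\ forall w, E v w -> sim (tm w) (gb.1 w),
      forall ws, is_children E v ws ->
        exists2 c, is_case_P c <-> gb.2 &
          rewrites Q c u [seq ((pr w / pr v)%R, gb.1 w) | w <- ws]
    & VP v -> gb.2].
(* The choice is made for all pairs of a node and a term at once, because the new term at a node is
   known only after following the path to it. *)
have /choice[G GP] (vu : T * aterm) :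
    exists gb, sim (tm vu.1) vu.2 -> inner E vu.1 -> good vu.1 vu.2 gb.
  case: vu => v u /=; have [[svu Ev]|nv] := pselect (sim (tm v) u /\ inner E v); last first.
    by exists (tm, true) => svu Ev; case: nv.
  have [ws wsP] := children v.
  have [c cVP rew] : exists2 c, VP v -> is_case_P c &
      rewrites P c (tm v) [seq ((pr w / pr v)%R, tm w) | w <- ws].
    have [VPv|nVPv] := pselect (VP v).
      by have [c cP rew] := ctP v ws VPv wsP; exists c.
    by have [c cP rew] := ctR v ws Ev nVPv wsP; exists c.
  have [c' [mu' [rew' F2 cc']]] := simP _ _ _ _ svu rew.
  have [g' mu'E gP] := Forall2_uniq_fun _ _ _ (fun w => ((pr w / pr v)%R, tm w)) _ _ wsP.1 F2.
  exists (fun w => (g' w).2, `[< is_case_P c' >]) => _ _; split => /=.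
  - by move=> w Evw; have [|_] := gP w; first by rewrite wsP.2.
  - move=> ws' wsP'; exists c'; first by split => /asboolP.
    apply: rewrites_perm rew'; rewrite mu'E.
    rewrite (_ : [seq g' x | x <- ws] = [seq ((pr w / pr v)%R, (g' w).2) | w <- ws]).
      have := is_children_Permutation _ _ _ _ _ wsP wsP'.
      exact: (@Permutation_map _ _ (fun w => ((pr w / pr v)%R, (g' w).2))).
    apply/eq_in_map => w /gP[/= e _]; by rewrite e; case: (g' w).
  - by move=> VPv; apply/asboolP; auto.
(* The new label is carried along the path from the root; unique paths make it a function [tm'] of
   the node. *)
pose next (vu : T * aterm) w := (w, (G vu).1 w).
pose run (s : seq T) := foldl next (root, tm root) s.
have run1 (s : seq T) : (run s).1 = last root s.
  by rewrite /run; elim/last_ind: s => [//|s w _]; rewrite foldl_rcons last_rcons.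
have run_sim (s : seq T) : path E root s -> sim (tm (last root s)) (run s).2.
  elim/last_ind: s => [_|s w IH]; first exact: sim_refl.
  rewrite rcons_path => /andP[ps Ew].
  rewrite last_rcons /run foldl_rcons -/(run s) /=.
  have [] := GP (run s); rewrite ?run1; [exact: IH|by exists w|].
  by move=> h _ _; apply: h.
have /choice[rpath rpathP] v : exists s : seq T, path E root s /\ last root s = v.
  by have [s [? _]] := tree v; exists s.
have rpath_child v w : E v w -> rpath w = rcons (rpath v) w.
  move=> Evw; have [s [_ uniq_s]] := tree w.
  rewrite -(uniq_s (rpath w)) ?rpathP//; apply: uniq_s.
  have [p1 p2] := rpathP v.
  by rewrite rcons_path last_rcons p1 p2 Evw.
pose tm' v := (run (rpath v)).2.
have runE v : run (rpath v) = (v, tm' v).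
  by rewrite [LHS]surjective_pairing run1 (rpathP v).2.
have tm'_sim v : sim (tm v) (tm' v).
  by have [p1 p2] := rpathP v; have := run_sim _ p1; rewrite p2.
have tm'_child v w : E v w -> tm' w = (G (v, tm' v)).1 w.
  move=> Evw; rewrite /tm' (rpath_child _ _ Evw) /run foldl_rcons.
  by rewrite -/(run (rpath v)) runE.
have good_tm' v : inner E v -> good v (tm' v) (G (v, tm' v)).
  exact: (GP (v, tm' v)).
have relabel v ws : is_children E v ws ->
    [seq ((pr w / pr v)%R, (G (v, tm' v)).1 w) | w <- ws] =
    [seq ((pr w / pr v)%R, tm' w) | w <- ws].
  by move=> [_ wsP]; apply/eq_in_map => w; rewrite wsP => /tm'_child ->.
(* The new set contains [VP], so the condition on infinite paths is inherited. *)
apply: (Qast T E pr tm' [set v | inner E v /\ (G (v, tm' v)).2]); split => //.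
- by exists root.
- by move=> v [].
- move=> v ws [Ev Gv] wsP; have [_ /(_ _ wsP)[c cG rew] _] := good_tm' _ Ev.
  by exists c; [exact/cG|rewrite -relabel].
- move=> v ws Ev nv wsP; have [_ /(_ _ wsP)[c cG rew] _] := good_tm' _ Ev.
  exists c; last by rewrite -relabel.
  by apply: is_case_R => /cG Gv; apply: nv.
- move=> f fE n; have [n' nn' VPn'] := inf f fE n; exists n' => //.
  have Ev := VPin _ VPn'; split => //.
  by have [_ _] := good_tm' _ Ev; apply.
Qed.

(** One half of a step simulation: the exchange of the rule, with the same plain redex. The other
    half, [context_simulation], puts related instances of right-hand sides into related contexts. *)
Definition rule_simulation P Q (sim : aterm -> aterm -> Prop) : Prop :=
  forall a s, P a -> ANF P (plain (subst s (lhs a))) -> exists a' s',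
    [/\ Q a', subst s' (lhs a') = subst s (lhs a), flag a' = flag a
      & Forall2 (fun q q' => q.1 = q'.1 /\ sim (asubst s q.2) (asubst s' q'.2))
          (rhs a) (rhs a')].

Definition context_simulation P (sim : aterm -> aterm -> Prop) : Prop :=
  forall t t' pi u, sim t t' -> subterm_at t pi = Some u -> redex P (flat u) ->
    exists u', [/\ subterm_at t' pi = Some u', flat u' = flat u,
      root_annotated u -> root_annotated u'
      & forall m s s' (r r' : aterm), sim (asubst s r) (asubst s' r') ->
        sim (contractum (rcase_of (root_annotated u) m) t pi s r)
            (contractum (rcase_of (root_annotated u') m) t' pi s' r')].

Lemma step_simulation_rules P Q (sim : aterm -> aterm -> Prop) :
  ANF P = ANF Q -> context_simulation P sim -> rule_simulation P Q sim ->
  step_simulation P Q sim.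
Proof.
move=> PQ ctx rules c t t' mu tt' [a [s [pi [u [Pa [e du] [eu anf] -> pm]]]]].
have ru : redex P (flat u) by exists a, s.
have [u' [e' eu' uu' simc]] := ctx _ _ _ _ tt' e ru.
have [a' [s' [Qa' es' ef F2]]] := rules a s Pa anf.
have F2' : Forall2 (fun q q' => q.1 = q'.1 /\ sim q.2 q'.2)
    [seq (q.1, contractum (rcase_of (root_annotated u) (flag a)) t pi s q.2) | q <- rhs a]
    [seq (q.1, contractum (rcase_of (root_annotated u') (flag a)) t' pi s' q.2) | q <- rhs a'].
  by apply: Forall2_map_impl F2 => q q' [q1 q2] /=; split => //; apply: simc.
have [mu' pm' F2mu] := Permutation_Forall2_lift _ _ _ _ _ pm F2'.
exists (rcase_of (root_annotated u') (flag a)), mu'; split => //.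
  exists a', s', pi, u'; split; rewrite ?ef//.
  - by split => //; rewrite root_defined_flat eu' -root_defined_flat.
  - by rewrite eu' eu es' -PQ.
by move=> /is_case_P_rcase_of /uu' ?; apply/is_case_P_rcase_of.
Qed.

(* No annotation at or above a redex can have been dropped. *)
Lemma context_simulation_drops_normal_form P :
  context_simulation P (drops (plain_normal_form P)).
Proof.
move=> t t' pi u tt' e ru.
have [u' e' uu'] := subterm_at_drops _ _ _ _ _ tt' e.
have nu : ~ plain_normal_form P (flat u).
  by move=> nf; apply: (nf [::] (flat u)) => //; rewrite subterm_at0.
have ann : root_annotated u = root_annotated u'.
  have [i1 i2] := root_annotated_drops _ _ _ uu'.
  by apply/idP/idP => // /i2[].
exists u'; split => //; first exact: flat_drops uu'.
  by rewrite ann.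
move=> m s s' r r' rr'; apply: contractum_drops tt' e rr' _; last by left.
by move=> w rho w' nw ew; case: nu; apply: plain_normal_form_subterm nw ew.
Qed.

(** The simulating term has more annotations. If its redex alone is annotated, it receives an
    annotated contractum where the other term receives a flat one, which the trivial [drops]
    permits. *)
Lemma context_simulation_adds P :
  context_simulation P (fun t' t => drops (fun=> True) t t').
Proof.
move=> t' t pi u' tt' e' ru.
have [u e] : exists u, subterm_at t pi = Some u.
  have := subterm_at_flat t pi; rewrite -(flat_drops _ _ _ tt') subterm_at_flat e'.
  by case: subterm_at => [u|//]; exists u.
have uu' : drops (fun=> True) u u'.
  by have [u2] := subterm_at_drops _ _ _ _ _ tt' e; rewrite e' => -[<-].
have ann := (root_annotated_drops _ _ _ uu').1.
exists u; split => //; first by rewrite (flat_drops _ _ _ uu').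
move=> m s s' r r' rr'; apply: contractum_drops tt' e rr' _ => //.
case: (root_annotated u) (root_annotated u') ann => [] [] h; auto.
Qed.

End Rewriting.

(** * Soundness and completeness of the processor *)

Theorem theorem43 (R : realType) (Sig : signature) (V : Type)
  (P P' : set (adp R Sig V))
  (l : pterm Sig V) (k : nat) (p : 'I_k -> R) (r : 'I_k -> aterm Sig V) (m : bool)
  (hP : P = P' `|` [set Adp l [seq (p i, r i) | i <- enum 'I_k] m])
  (hdisj : forall a, P' a -> ~ adp_equiv a (Adp l [seq (p i, r i) | i <- enum 'I_k] m))
  (hprob : adp_problem P)
  (vrP : set (adp R Sig V)) (hvr : renamed_copy P vrP)
  (j : 'I_k) (t : pterm Sig V) (ht : annotated_subterm t (r j))
  (d : nat) (delta : 'I_d -> V -> pterm Sig V)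
  (hdelta : all_narrowing_substs P vrP l t delta)
  (N : set (adp R Sig V))
  (hN : N =
    [set b | exists e : 'I_d,
       b = Adp (subst (delta e) l)
               [seq (p i, asubst (delta e) (r i)) | i <- enum 'I_k] m]
    `|` [set Adp l
               [seq (p i, reannotate (capt P vrP l delta (r i)) (r i)) | i <- enum 'I_k] m]) :
  iAST P <-> iAST (P' `|` N).
Proof.
set A := Adp l _ m in hP; set B := Adp l _ m in hN; set Q := P' `|` N.
have PA : P A by rewrite hP; right.
have P'P a : P' a -> P a by rewrite hP; left.
have QB : Q B by right; rewrite hN; right.
have Qe e : Q (Adp (subst (delta e) l) [seq (p i, asubst (delta e) (r i)) | i <- enum 'I_k] m).
  by right; rewrite hN; left; exists e.
have [lroot _ rl] := hprob.2 _ PA.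
have lVar x : l <> Var x by move=> e; move: lroot; rewrite /A /= e.
have vars_r i : vars (r i) `<=` vars l.
  apply: (rl (p i, r i)); rewrite /A /=.
  have : i \in enum 'I_k by rewrite mem_enum.
  elim: (enum _) => [//|i' js IH]; rewrite inE => /predU1P[->|/IH]; by [left|right].
have redexPQ w : redex P w <-> redex Q w.
  split=> -[a [s [+ ->]]].
    rewrite hP => -[P'a|->]; last by exists B, s.
    by exists a, s; split => //; left.
  move=> [P'a|]; first by exists a, s; split => //; apply: P'P.
  rewrite hN => -[[e ->]|->] /=; last by exists A, s.
  by exists A, (comp_subst (delta e) s); rewrite subst_comp.
have ANF_PQ := eq_ANF _ _ redexPQ.
split.
  (* Completeness: chain trees of [Q] are simulated in [P]. *)
  apply: (iAST_simulation _ _ (fun t' t => drops (fun=> True) t t')).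
    by move=> ?; apply: drops_refl.
  apply: step_simulation_rules => //; first exact: context_simulation_adds.
  move=> a s [P'a _|].
    exists a, s; split => //; first exact: P'P.
    by elim: (rhs a) => [|q qs IH]; constructor => //; split => //; apply: drops_refl.
  rewrite hN => -[[e ->]|->] _ /=.
    exists A, (comp_subst (delta e) s); split => //; first by rewrite subst_comp.
    apply: Forall2_map_seq => i /=; split => //.
    by rewrite asubst_comp; apply: drops_refl.
  exists A, s; split => //; apply: Forall2_map_seq => i /=; split => //.
  apply: drops_asubst; apply: drops_reannotate => // pi [u [e ua _]].
  by exists u.
(* Soundness: chain trees of [P] are simulated in [Q]. *)
apply: (iAST_simulation _ _ (drops (plain_normal_form P))).
  by move=> ?; apply: drops_refl.
apply: step_simulation_rules => //; first exact: context_simulation_drops_normal_form.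
move=> a s; rewrite {1}hP => -[P'a _|-> anf].
  exists a, s; split => //; first by left.
  by elim: (rhs a) => [|q qs IH]; constructor => //; split => //; apply: drops_refl.
(* Agreement on the variables of [l] suffices in the first case, since the right-hand sides have no
   others. *)
have [[e [s' es']]|ninst] :=
    pselect (exists e s', forall x, vars l x -> s x = subst s' (delta e x)).
  eexists; exists s'; split; [exact: (Qe e)|rewrite /= subst_comp|by []|].
    by apply: eq_subst => x /es'.
  apply: Forall2_map_seq => i /=; split => //; rewrite asubst_comp.
  have -> : asubst (comp_subst (delta e) s') (r i) = asubst s (r i).
    by apply: eq_asubst => x /vars_r/es'.
  exact: drops_refl.
exists B, s; split => //; apply: Forall2_map_seq => i /=; split => //.
apply: drops_asubst; apply: drops_reannotate => [pi [u [e ua _]]|pi u e ua nu].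
  by exists u.
apply: (captured_normal_form P vrP l d delta) => //; first by exists A.
  by rewrite vars_flat => x /(vars_subterm _ _ _ e)/vars_r.
(* An annotated position outside [capt] carries a captured term, by double negation. *)
by apply: contrapT => nc; apply: nu; exists u.
Qed.
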